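(* Let $\mathbb{F}$ be a field and $n\geq 1$. Every nilpotent symplectic alternating algebra $L$ over $\mathbb{F}$ of dimension $2n$ has a nilpotent presentation, i.e. $L$ has a standard basis $x_1,y_1,\ldots,x_n,y_n$ and there are elements $\alpha(i,j,k),\beta(i,j,k)\in\mathbb{F}$ ($1\leq i<j<k\leq n$) such that $$(x_iy_j,y_k)=\alpha(i,j,k),\qquad (y_iy_j,y_k)=\beta(i,j,k)\qquad (1\leq i<j<k\leq n),$$ while $(uv,w)=0$ for all triples $u,v,w$ of basis elements that are not, up to reordering, of the form $x_i,y_j,y_k$ or $y_i,y_j,y_k$ with $1\leq i<j<k\leq n$. Conversely, for any choice of elements $\alpha(i,j,k),\beta(i,j,k)\in\mathbb{F}$ ($1\leq i<j<k\leq n$), the symplectic alternating algebra of dimension $2n$ determined by these data in this way is nilpotent.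
   Context: A symplectic alternating algebra (SAA) over a field $\mathbb{F}$ is a finite-dimensional vector space $L$ over $\mathbb{F}$ with a non-degenerate alternating bilinear form $(\ ,\ )$ and a bilinear product $\cdot$ satisfying $u\cdot u=0$ for all $u$ and $(u\cdot v,w)=(v\cdot w,u)$ for all $u,v,w\in L$. No associativity or Jacobi identity is assumed. The map $(u,v,w)\mapsto (uv,w)$ is then an alternating trilinear form, and its values on triples of distinct basis elements determine the product. A standard basis of a $2n$-dimensional SAA is a basis $x_1,y_1,\ldots,x_n,y_n$ with $(x_i,x_j)=(y_i,y_j)=0$ and $(x_i,y_j)=\delta_{ij}$ for all $i,j$. For subspaces $U,V$, $UV$ is the subspace spanned by all products $uv$, $u\in U$, $v\in V$. Put $L^1=L$ and $L^{m+1}=L^mL$. $L$ is nilpotent if $L^{m+1}=\{0\}$ for some $m\geq 0$. *)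

(* Defs.v *)
From mathcomp Require Import all_boot all_order all_algebra.

Set Implicit Arguments.
Unset Strict Implicit.
Unset Printing Implicit Defensive.

Import GRing.Theory.
Local Open Scope ring_scope.

Record saa (F : fieldType) : Type := SAA {
  saa_space :> vectType F;
  saa_form : {biscalar saa_space};
  saa_mul : {bilinear saa_space -> saa_space -> saa_space};
  saa_form_alternating : forall u, saa_form u u = 0;
  saa_form_nondegenerate : forall u, (forall v, saa_form u v = 0) -> u = 0;
  saa_mul_alternating : forall u, saa_mul u u = 0;
  saa_form_mul_cyclic : forall u v w,
    saa_form (saa_mul u v) w = saa_form (saa_mul v w) u
}.

Section Nilpotency.
Variables (F : fieldType) (L : saa F).

(* By bilinearity, products of basis vectors span the same subspace as all
   products u v with u in U and v in V: see saa_prodvP. *)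
Definition saa_prodv (U V : {vspace L}) : {vspace L} :=
  <<allpairs (saa_mul L) (vbasis U) (vbasis V)>>%VS.

Lemma saa_memv_prod (U V : {vspace L}) (u v : L) :
  u \in U -> v \in V -> saa_mul L u v \in saa_prodv U V.
Proof.
move=> /coord_vbasis -> /coord_vbasis ->.
rewrite linear_sumlz; apply: memv_suml => i _.
rewrite linear_sumr; apply: memv_suml => j _.
rewrite linearZl_LR linearZr_LR !memvZ // memv_span //.
by apply/allpairs_f; apply: mem_nth; rewrite size_tuple.
Qed.

Lemma saa_prodvP (U V W : {vspace L}) :
  reflect (forall u v, u \in U -> v \in V -> saa_mul L u v \in W)
          (saa_prodv U V <= W)%VS.
Proof.
apply: (iffP idP) => [sUVW u v uU vV | sUVW].
  by apply: (subvP sUVW); apply: saa_memv_prod.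
apply/span_subvP => _ /allpairsP [[u v] [/= uU vV ->]].
by apply: sUVW; apply: vbasis_mem.
Qed.

(* L^m for m >= 1. *)
Definition saa_power (m : nat) : {vspace L} :=
  iter m.-1 (fun U => saa_prodv U {:L}) {:L}%VS.

Definition saa_nilpotent : Prop := exists m : nat, saa_power m.+1 = 0%VS.

End Nilpotency.

Section Presentation.
Variables (F : fieldType) (L : saa F) (n : nat).

Definition standard_basis (x y : 'I_n -> L) : Prop :=
  [/\ basis_of {:L} (codom x ++ codom y),
      forall i j, saa_form L (x i) (x j) = 0,
      forall i j, saa_form L (y i) (y j) = 0 &
      forall i j, saa_form L (x i) (y j) = (i == j)%:R].

(* Only the values alpha i j k and beta i j k with i < j < k are used. *)
Definition nilpotent_presentation (x y : 'I_n -> L)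
    (alpha beta : 'I_n -> 'I_n -> 'I_n -> F) : Prop :=
  [/\ standard_basis x y,
      forall i j k : 'I_n, (i < j < k)%N ->
        saa_form L (saa_mul L (x i) (y j)) (y k) = alpha i j k,
      forall i j k : 'I_n, (i < j < k)%N ->
        saa_form L (saa_mul L (y i) (y j)) (y k) = beta i j k &
      forall u v w : L,
        u \in codom x ++ codom y ->
        v \in codom x ++ codom y ->
        w \in codom x ++ codom y ->
        ~ (exists i j k : 'I_n, (i < j < k)%N /\
             (perm_eq [:: u; v; w] [:: x i; y j; y k] \/
              perm_eq [:: u; v; w] [:: y i; y j; y k])) ->
        saa_form L (saa_mul L u v) w = 0].

End Presentation.

(* Main.v *)
Require Import Defs.
From HB Require Import structures.
From mathcomp Require Import all_boot all_order all_algebra.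
From mathcomp Require Import ring zify.

Set Implicit Arguments.
Unset Strict Implicit.
Unset Printing Implicit Defensive.

Import GRing.Theory.
Local Open Scope ring_scope.

(** Both directions pass through one property of a standard basis,
    [triangular_basis]: the triples (x_i x_j, w) all vanish, and the triples
    (x_i y_j, w) vanish for j <= i.  Because (uv, w) is an alternating trilinear
    form, this says exactly that the only nonzero triples of basis vectors are
    the listed ones ([triangular_basis_presentation] and
    [presentation_triangular]).

    From nilpotency to a presentation: build, one vector at a time, independent
    pairwise orthogonal vectors such that the product of each of them with
    anything lies in the span of the earlier ones.  Their span I is an ideal, so
    its orthogonal I^perp is one too.  As long as I has dimension less than n
    there is a vector of I^perp outside I ([exists_orthogonal_outside]);
    multiplying it repeatedly stays in I^perp and, by nilpotency, ends in I, and
    the last vector outside I extends the family ([isotropic_flag_cons]).  After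
    n steps I is Lagrangian.  Numbering its vectors backwards as x_1, ..., x_n
    and completing them by a dual isotropic family y
    ([lagrangian_standard_basis]) gives a standard basis in which x_i L lies in
    the span of the x_j with j > i; cyclicity of (uv, w) turns this into
    triangularity ([isotropic_flag_triangular]).

    From a presentation to nilpotency: order the basis as
    y_n, ..., y_1, x_1, ..., x_n.  Triangularity says that multiplication by any
    vector moves each basis vector into the span of the strictly later ones
    ([level_space_mul]), so L^(2n+1) = 0.

    Existence: on pairs of row vectors with the standard symplectic form, the
    trilinear form with the prescribed values is a sum of 3 x 3 determinants of
    coordinates ([presented_triple]); nondegeneracy converts it into a product
    ([presented_mul]). *)

(** * Symplectic linear algebra and isotropic flags *)

Section SymplecticLinearAlgebra.
Variables (F : fieldType) (L : saa F).
Implicit Types (u v w : L) (s : seq L).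
Local Notation form := (saa_form L).
Local Notation mul := (saa_mul L).

Lemma saa_formC u v : form u v = - form v u.
Proof.
apply/eqP; rewrite -addr_eq0 -(saa_form_alternating (u + v)).
by rewrite linearDl !linearDr /= !saa_form_alternating add0r addr0.
Qed.

Lemma saa_mulC u v : mul u v = - mul v u.
Proof.
apply/eqP; rewrite -addr_eq0 -(saa_mul_alternating (u + v)).
by rewrite linearDl !linearDr /= !saa_mul_alternating add0r addr0.
Qed.

Lemma saa_triple_swap u v w : form (mul v u) w = - form (mul u v) w.
Proof. by rewrite saa_mulC linearNl. Qed.

Lemma span_codomP n (x : 'I_n -> L) u :
  u \in <<codom x>>%VS -> exists c : 'I_n -> F, u = \sum_i c i *: x i.
Proof.
rewrite span_def big_map big_enum /= => /memv_sumP[us us_line ->].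
have coefP i : exists c, us i == c *: x i.
  by have /vlineP[c ->] := us_line i isT; exists c.
exists (fun i => xchoose (coefP i)); apply: eq_bigr => i _.
exact/eqP/(xchooseP (coefP i)).
Qed.

Lemma saa_form_suml n (c : 'I_n -> F) (x : 'I_n -> L) v :
  form (\sum_i c i *: x i) v = \sum_i c i * form (x i) v.
Proof. by rewrite linear_sumlz; apply: eq_bigr => i _; rewrite linearZl_LR. Qed.

Lemma saa_form_sumr n (c : 'I_n -> F) (x : 'I_n -> L) v :
  form v (\sum_i c i *: x i) = \sum_i c i * form v (x i).
Proof. by rewrite linear_sumr; apply: eq_bigr => i _; rewrite linearZr_LR. Qed.

Lemma sum_delta n (c : 'I_n -> F) j : \sum_i c i * (i == j)%:R = c j.
Proof.
rewrite (big_only1 j) ?eqxx ?mulr1 // => i /negPf-> _.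
by rewrite mulr0.
Qed.

Lemma biorthogonal_free n (x y : 'I_n -> L) :
  (forall i j, form (x i) (y j) = (i == j)%:R) -> free (codom x).
Proof.
move=> xy; suff: free (map_tuple x (ord_tuple n)) by [].
apply/freeP => c cx j.
rewrite -(sum_delta c) -[RHS](linear0l form (y j)) -cx linear_sumlz.
apply: eq_bigr => i _.
by rewrite linearZl_LR -tnth_nth tnth_map tnth_ord_tuple xy.
Qed.

(** The span of x meets the span of y trivially because pairing with the y_j
    reads off the x-coordinates and kills the span of y; the dimension count
    does the rest. *)
Lemma standard_basisP n (x y : 'I_n -> L) :
  \dim {:L} = (2 * n)%N ->
  (forall i j, form (x i) (x j) = 0) -> (forall i j, form (y i) (y j) = 0) ->
  (forall i j, form (x i) (y j) = (i == j)%:R) ->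
  standard_basis x y.
Proof.
move=> dimL xx yy xy; split=> //.
rewrite basisEfree subvf size_cat !size_codom card_ord dimL mul2n addnn leqnn.
rewrite !andbT cat_free (biorthogonal_free xy).
rewrite (biorthogonal_free (y := fun i => - x i)) /=; last first.
  by move=> i j; rewrite linearNr saa_formC opprK xy eq_sym.
apply/directv_addP/eqP; rewrite -subv0; apply/subvP => u.
rewrite memv_cap => /andP[/span_codomP[c ->] /span_codomP[d eq_cd]].
have c0 j : c j = 0.
  rewrite -(sum_delta c); have := congr1 (form^~ (y j)) eq_cd.
  rewrite !saa_form_suml; under eq_bigr do rewrite xy.
  by move=> ->; apply: big1 => i _; rewrite yy mulr0.
by rewrite memv0 big1 // => i _; rewrite c0 scale0r.
Qed.

(** By nondegeneracy, the matrix of pairings of X with a basis of L has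
    independent columns, hence a left inverse, whose rows are the coordinates of
    the dual vectors. *)
Lemma dual_family n (X : n.-tuple L) :
  free X -> exists y : 'I_n -> L, forall i j : 'I_n, form X`_i (y j) = (i == j)%:R.
Proof.
move=> /freeP freeX; set e := vbasis {:L}.
pose A := \matrix_(k < \dim {:L}, i < n) form X`_i e`_k.
have /row_fullP[B BA] : row_full A.
  rewrite /row_full -mxrank_tr; apply: inj_row_free => c cA.
  suff {}/freeX c0 : \sum_i c 0 i *: X`_i = 0.
    by apply/rowP => i; rewrite c0 mxE.
  apply: saa_form_nondegenerate => u; rewrite (coord_vbasis (memvf u)).
  rewrite linear_sumr big1 // => k _; rewrite linearZr_LR /= saa_form_suml.
  have /rowP/(_ k) := cA; rewrite !mxE => cAk.
  rewrite [X in _ * X](_ : _ = 0) ?mulr0 // -[RHS]cAk.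
  by apply: eq_bigr => i _; rewrite !mxE.
exists (fun j => \sum_k B j k *: e`_k) => i j.
rewrite saa_form_sumr; have /matrixP/(_ j i) := BA; rewrite !mxE eq_sym => <-.
by apply: eq_bigr => k _; rewrite mxE.
Qed.

(** A dual family z of X need not be isotropic.  Adding to z_i the combination
    of the X_j with j > i and coefficients -(z_i, z_j) cancels each (z_i, z_j)
    exactly once; no division by 2 is involved, so every characteristic is
    covered. *)
Lemma lagrangian_standard_basis n (X : n.-tuple L) :
  \dim {:L} = (2 * n)%N -> free X -> {in X &, forall u v, form u v = 0} ->
  exists y : 'I_n -> L, standard_basis (fun i => X`_i) y.
Proof.
move=> dimL freeX isoX; have [z xz] := dual_family freeX.
have xx (i j : 'I_n) : form X`_i X`_j = 0 by apply: isoX; rewrite mem_nth ?size_tuple.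
pose c (i j : 'I_n) := if (i < j)%N then - form (z i) (z j) else 0.
exists (fun i => z i + \sum_k c i k *: X`_k).
apply: standard_basisP => // i j; last first.
  by rewrite linearDr xz saa_form_sumr big1 ?addr0 // => k _; rewrite xx mulr0.
rewrite linearDl !linearDr /= saa_form_sumr !saa_form_suml.
rewrite [X in _ + (_ + X)]big1 => [|k _]; last first.
  by rewrite saa_form_sumr big1 ?mulr0 // => l _; rewrite xx mulr0.
under eq_bigr do rewrite saa_formC xz mulrN.
rewrite sumrN sum_delta; under eq_bigr do rewrite xz.
rewrite sum_delta addr0 /c.
case: ltngtP => [_|_|/val_inj->].
- by rewrite addr0 opprK saa_formC addNr.
- by rewrite subr0 subrr.
- by rewrite saa_form_alternating subr0 addr0.
Qed.

(** The tails of s span a descending chain of isotropic subspaces, and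
    multiplication by L sends each of them into the next.  New vectors are
    therefore added at the head. *)
Definition isotropic_flag s :=
  [/\ free s, {in s &, forall u v, form u v = 0} &
      forall i u, (i < size s)%N -> mul s`_i u \in <<drop i.+1 s>>%VS].

Lemma isotropic_flag_ideal s u v :
  isotropic_flag s -> u \in <<s>>%VS -> mul u v \in <<s>>%VS.
Proof.
case=> _ _ s_desc /(@coord_span _ _ _ (in_tuple s)) ->.
rewrite linear_sumlz; apply: memv_suml => i _; rewrite linearZl_LR memvZ //=.
by apply: subvP (s_desc i v (ltn_ord i)); apply/sub_span => w /mem_drop.
Qed.

Lemma form_span_eq0 s u v :
  {in s, forall w, form w v = 0} -> u \in <<s>>%VS -> form u v = 0.
Proof.
move=> sv /(@coord_span _ _ _ (in_tuple s)) ->.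
rewrite saa_form_suml big1 // => i _.
by rewrite sv ?mulr0 // mem_nth.
Qed.

(** If y is dual to s, then s and y together have fewer than 2n vectors; any
    vector outside their span becomes orthogonal to s after subtracting a
    combination of the y_i, and it stays outside the span of s. *)
Lemma exists_orthogonal_outside n s :
  \dim {:L} = (2 * n)%N -> free s -> (size s < n)%N ->
  exists2 u, u \notin <<s>>%VS & {in s, forall w, form w u = 0}.
Proof.
move=> dimL free_s lt_s_n; have [y sy] := @dual_family _ (in_tuple s) free_s.
have /subvPn[u _ u_out] : ~~ ({:L} <= <<s ++ codom y>>)%VS.
  apply/negP => /dimvS; rewrite dimL => /leq_trans/(_ (dim_span _)).
  by rewrite size_cat size_codom card_ord; lia.
exists (u - \sum_(i < size s) form s`_i u *: y i).
  apply: contra u_out => u'_in.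
  rewrite -[u](subrK (\sum_(i < size s) form s`_i u *: y i)).
  rewrite span_cat memv_add // memv_suml // => i _.
  by rewrite memvZ // memv_span ?codom_f.
move=> w /(nthP 0)[i lt_i <-].
rewrite linearBr /= saa_form_sumr.
under eq_bigr do rewrite (sy (Ordinal lt_i)) eq_sym.
by rewrite sum_delta subrr.
Qed.

(** Starting from a vector orthogonal to s and outside its span, multiply by
    basis vectors for as long as some product is still outside the span.
    Orthogonality to s persists because the span of s is an ideal, and the
    process stops because the j-th product lies in L^(j+1). *)
Lemma isotropic_flag_cons n s :
  \dim {:L} = (2 * n)%N -> saa_nilpotent L ->
  isotropic_flag s -> (size s < n)%N -> exists v, isotropic_flag (v :: s).
Proof.
move=> dimL [m Lm0] flag_s lt_s_n; have [free_s iso_s desc_s] := flag_s.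
have [u u_out su] := exists_orthogonal_outside dimL free_s lt_s_n.
suff [v [v_out sv v_desc]] : exists v, [/\ v \notin <<s>>%VS,
    {in s, forall w, form w v = 0} & forall w, mul v w \in <<s>>%VS].
  exists v; split=> [|a b|[|i] w]; rewrite ?free_cons ?v_out //=.
  - rewrite !inE => /predU1P[->|sa] /predU1P[->|sb].
    + exact: saa_form_alternating.
    + by rewrite saa_formC sv ?oppr0.
    + exact: sv.
    + exact: iso_s.
  - by rewrite drop0.
  - exact: desc_s.
(* Here w lies in L^(j+1), and k bounds the number of multiplications left. *)
suff descent k j w : (j + k = m)%N -> w \in saa_power L j.+1 ->
    w \notin <<s>>%VS -> {in s, forall a, form a w = 0} ->
    exists v, [/\ v \notin <<s>>%VS, {in s, forall a, form a v = 0} &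
      forall a, mul v a \in <<s>>%VS].
  by apply: (descent m 0 u) => //; rewrite memvf.
elim: k j w => [|k IHk] j w.
  by rewrite addn0 => ->; rewrite Lm0 memv0 => /eqP->; rewrite mem0v.
rewrite addnS -addSn => jk wL w_out sw.
have [/allP w_in | /allPn[e _ we_out]] :=
  boolP (all (fun e => mul w e \in <<s>>%VS) (vbasis {:L})).
  exists w; split=> // a; rewrite (coord_vbasis (memvf a)) linear_sumr.
  apply: memv_suml => i _; rewrite linearZr_LR memvZ // w_in //.
  by rewrite mem_nth ?size_tuple.
apply: (IHk j.+1 (mul w e)) => // [|a sa].
  by apply: saa_memv_prod; rewrite ?memvf.
rewrite saa_formC saa_form_mul_cyclic saa_triple_swap opprK.
apply: form_span_eq0 sw _; apply: isotropic_flag_ideal flag_s _.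
exact: memv_span.
Qed.
Lemma lagrangian_isotropic_flag n :
  \dim {:L} = (2 * n)%N -> saa_nilpotent L ->
  exists2 s, size s = n & isotropic_flag s.
Proof.
move=> dimL nilL.
suff /(_ n (leqnn n)) : forall k, (k <= n)%N ->
  exists2 s, size s = k & isotropic_flag s by [].
elim=> [_ | k IHk lt_kn].
  by exists [::] => //; split=> //; rewrite nil_free.
have [s size_s flag_s] := IHk (ltnW lt_kn); rewrite -size_s in lt_kn *.
have [v flag_vs] := isotropic_flag_cons dimL nilL flag_s lt_kn.
by exists (v :: s).
Qed.

End SymplecticLinearAlgebra.

(** * Triangular bases *)

Section Triangularity.
Variables (F : fieldType) (L : saa F) (n : nat) (x y : 'I_n -> L).
Implicit Types (u v w : L) (s : seq L).
Local Notation form := (saa_form L).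
Local Notation mul := (saa_mul L).

(** For a standard basis this says, by cyclicity, that x_i L lies in the span of the x_j with j > i. *)
Definition triangular_basis :=
  (forall i j w, form (mul (x i) (x j)) w = 0) /\
  (forall (i j : 'I_n) w, (j <= i)%N -> form (mul (x i) (y j)) w = 0).

(** Up to sign (x_i v, w) is (x_i w, v), which vanishes as soon as v is
    orthogonal to the x_j with j > i; this applies to v = x_j always, and to
    v = y_j when j <= i. *)
Lemma isotropic_flag_triangular (s : n.-tuple L) :
  (forall i : 'I_n, x i = s`_i) -> isotropic_flag s -> standard_basis x y ->
  triangular_basis.
Proof.
move=> xs [_ _ desc_s] [_ xx _ xy].
have x_tail (i : 'I_n) w v :
    (forall j : 'I_n, (i < j)%N -> form (x j) v = 0) -> form (mul (x i) w) v = 0.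
  have lt_i : (i < size s)%N by rewrite size_tuple.
  move=> tail_v; rewrite xs; apply: (form_span_eq0 _ (desc_s i w lt_i)).
  move=> _ /(nthP 0)[k + <-]; rewrite size_drop size_tuple nth_drop => lt_k.
  have lt_ik : (i.+1 + k < n)%N by lia.
  by rewrite -(xs (Ordinal lt_ik)) tail_v //= ltnS leq_addr.
split=> i j w => [|le_ji]; rewrite -saa_form_mul_cyclic saa_triple_swap.
  by rewrite x_tail ?oppr0.
rewrite x_tail ?oppr0 // => k lt_ik; rewrite xy.
by case: eqP => // eq_kj; move: lt_ik; rewrite eq_kj ltnNge le_ji.
Qed.

(** The triples of basis vectors that a nilpotent presentation allows to be
    nonzero. *)
Definition presented s := exists i j k : 'I_n, (i < j < k)%N /\
  (perm_eq s [:: x i; y j; y k] \/ perm_eq s [:: y i; y j; y k]).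

Lemma presented_perm s t : perm_eq s t -> presented s -> presented t.
Proof.
rewrite perm_sym => ts [i [j [k [ijk s_ijk]]]]; exists i, j, k; split=> //.
by case: s_ijk => [/(perm_trans ts)|/(perm_trans ts)]; [left | right].
Qed.

Hypothesis xy_std : standard_basis x y.

(** Rotating a triple brings any x it contains to the front, where
    triangularity applies; three distinct y can always be sorted into a listed
    triple. *)
Lemma triangular_basis_presentation alpha beta :
  triangular_basis ->
  (forall i j k : 'I_n, (i < j < k)%N ->
     form (mul (x i) (y j)) (y k) = alpha i j k) ->
  (forall i j k : 'I_n, (i < j < k)%N ->
     form (mul (y i) (y j)) (y k) = beta i j k) ->
  nilpotent_presentation x y alpha beta.
Proof.
move=> [xx_0 xy_0] def_alpha def_beta; split=> // u v w.
have cyc := saa_form_mul_cyclic; have alt := @saa_mul_alternating F L.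
have xyy i j k : ~ presented [:: x i; y j; y k] -> form (mul (x i) (y j)) (y k) = 0.
  move=> not_ijk; have [le_ji|lt_ij] := leqP j i; first exact: xy_0.
  have [le_ki|lt_ik] := leqP k i.
    by rewrite -cyc saa_triple_swap xy_0 ?oppr0.
  case: (ltngtP j k) => [lt_jk|lt_kj|/val_inj->].
  - by case: not_ijk; exists i, j, k; rewrite lt_ij lt_jk perm_refl; split; last left.
  - case: not_ijk; exists i, k, j; rewrite lt_ik lt_kj; split=> //; left.
    by rewrite perm_cons (perm_catC [:: _] [:: _]).
  - by rewrite cyc alt linear0l.
have yyy i j k : ~ presented [:: y i; y j; y k] -> form (mul (y i) (y j)) (y k) = 0.
  move=> not_ijk; have [->|ij] := eqVneq i j; first by rewrite alt linear0l.
  have [->|jk] := eqVneq j k; first by rewrite cyc alt linear0l.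
  have [->|ik] := eqVneq i k; first by rewrite -cyc alt linear0l.
  case: not_ijk.
  have : (i < j < k)%N \/ (i < k < j)%N \/ (j < i < k)%N \/
         (j < k < i)%N \/ (k < i < j)%N \/ (k < j < i)%N.
    by move: ij jk ik; rewrite -!val_eqE /=; lia.
  by case=> [|[|[|[|[|]]]]] lt3; do 3 eexists; (split; first exact: lt3); right;
    apply/permP => p /=; ring.
rewrite !mem_cat => /orP[/codomP[i ->]|/codomP[i ->]]
  /orP[/codomP[j ->]|/codomP[j ->]] /orP[/codomP[k ->]|/codomP[k ->]] not_ijk //.
- by rewrite -cyc.
- exact: xyy.
- by rewrite cyc.
- rewrite cyc; apply: xyy => pres; apply: not_ijk.
  by apply: presented_perm pres; rewrite (perm_catC [:: _; _] [:: _]).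
- rewrite -cyc; apply: xyy => pres; apply: not_ijk.
  by apply: presented_perm pres; rewrite (perm_catC [:: _] [:: _; _]).
- exact: yyy.
Qed.

(** A listed triple contains at most one x, and every y in it has a larger index
    than that x.  Reading this off from the multiset of vectors requires x and y
    to be injective with disjoint images, which biorthogonality provides. *)
Lemma presentation_triangular alpha beta :
  nilpotent_presentation x y alpha beta -> triangular_basis.
Proof.
case: xy_std => bas xx yy xy [_ _ _ zero].
have onez := @oner_neq0 F.
have x_notin_y i : (x i \in codom y) = false.
  apply/negP => /codomP[j xi]; have := xy i i.
  by rewrite xi yy eqxx => /esym/eqP; rewrite (negPf onez).
have y_notin_x j : (y j \in codom x) = false.
  apply/negP => /codomP[i yj]; have := xy j j.
  by rewrite yj xx eqxx => /esym/eqP; rewrite (negPf onez).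
have y_inj : injective y.
  move=> i j eq_y; have := xy i j; rewrite -eq_y xy eqxx.
  by case: eqP => // _ /eqP; rewrite (negPf onez).
have x_inj : injective x.
  move=> i j eq_x; have := xy i j; rewrite eq_x xy eqxx.
  by case: eqP => // _ /eqP; rewrite (negPf onez).
have basis_enough u : {in codom x ++ codom y, forall w, form u w = 0} ->
    forall w, form u w = 0.
  move=> u0 w; rewrite saa_formC (@form_span_eq0 _ _ (codom x ++ codom y)) ?oppr0 //.
    by move=> b /u0 ub; rewrite saa_formC ub oppr0.
  by have /andP[/eqP-> _] := bas; rewrite memvf.
have inx i : x i \in codom x ++ codom y by rewrite mem_cat codom_f.
have iny i : y i \in codom x ++ codom y by rewrite mem_cat codom_f orbT.
split=> i j w => [|le_ji].
  (* Two x on the left against at most one on the right. *)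
  apply: basis_enough w => w w_in; apply: zero => // -[a [b [c [_ []]]]];
  by move=> /permP/(_ [in codom x]) /=; rewrite ?codom_f ?y_notin_x; lia.
apply: basis_enough w => w w_in; apply: zero => // -[a [b [c [abc []]]]].
  move=> /perm_mem pm; have := pm (x i); have := pm (y j).
  rewrite !inE !eqxx orbT /= => /esym yj /esym.
  rewrite (inj_eq x_inj); case/or3P => [/eqP ia|/eqP xb|/eqP xc].
  - move: yj; rewrite !(inj_eq y_inj); case/or3P=> [/eqP ya|/eqP jb|/eqP jc].
    + by have := y_notin_x j; rewrite ya codom_f.
    + by move: abc; rewrite -ia -jb; lia.
    + by move: abc; rewrite -ia -jc; lia.
  - by have := x_notin_y i; rewrite xb codom_f.
  - by have := x_notin_y i; rewrite xc codom_f.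
by move=> /permP/(_ [in codom x]) /=; rewrite ?codom_f ?y_notin_x; lia.
Qed.

Lemma standard_basis_expansion u :
  u = \sum_i form u (y i) *: x i + \sum_i form (x i) u *: y i.
Proof.
case: xy_std => /andP[/eqP full _] xx yy xy.
have := memvf u; rewrite -full span_cat.
case/memv_addP => a /span_codomP[c ->] [b /span_codomP[d ->] ->].
congr (_ + _); apply: eq_bigr => j _.
  rewrite linearDl /= !saa_form_suml [X in _ + X]big1 => [|i _]; last first.
    by rewrite yy mulr0.
  by under eq_bigr do rewrite xy; rewrite sum_delta addr0.
rewrite linearDr /= !saa_form_sumr [X in X + _]big1 => [|i _]; last first.
  by rewrite xx mulr0.
by under eq_bigr do rewrite xy eq_sym; rewrite sum_delta add0r.
Qed.

(** The span of the last 2n - m vectors in the order y_n, ..., y_1, x_1, ..., x_n: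
    with indices starting at 0, y_i has position n - 1 - i and x_i has position
    n + i. *)
Definition level_space m : {vspace L} :=
  (\sum_(i < n | (m <= n + i)%N) <[x i]> + \sum_(i < n | (m + i < n)%N) <[y i]>)%VS.

Lemma mem_level_space m u :
  (forall i : 'I_n, (n + i < m)%N -> form u (y i) = 0) ->
  (forall i : 'I_n, (n <= m + i)%N -> form (x i) u = 0) ->
  u \in level_space m.
Proof.
move=> ux uy; rewrite (standard_basis_expansion u); apply: memv_add.
  apply: memv_suml => i _; case: (leqP m (n + i)) => [le_m|/ux->]; last first.
    by rewrite scale0r mem0v.
  by apply: subvP (sumv_sup i _ (subvv _)) _ _; rewrite ?memvZ ?memv_line.
apply: memv_suml => i _; case: (ltnP (m + i) n) => [lt_m|/uy->]; last first.
  by rewrite scale0r mem0v.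
by apply: subvP (sumv_sup i _ (subvv _)) _ _; rewrite ?memvZ ?memv_line.
Qed.

(** For a basis vector u, the coordinates of uv at positions not after u are, up
    to sign, triples (x_i x_j, v) or (x_j y_i, v) with i <= j. *)
Lemma level_space_mul m u v :
  triangular_basis -> u \in level_space m -> mul u v \in level_space m.+1.
Proof.
move=> [xx_0 xy_0].
case/memv_addP => _ /memv_sumP[a a_x ->] [_ /memv_sumP[b b_y ->] ->].
rewrite linearDl !linear_sumlz memvD //; apply: memv_suml => i lvl_i.
  have /vlineP[c ->] := a_x i lvl_i; rewrite linearZl_LR memvZ //.
  apply: mem_level_space => j lvl_j.
    by rewrite 2!saa_form_mul_cyclic saa_triple_swap xy_0 ?oppr0 //; lia.
  by rewrite saa_formC -saa_form_mul_cyclic xx_0 oppr0.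
have /vlineP[c ->] := b_y i lvl_i; rewrite linearZl_LR memvZ //.
apply: mem_level_space => j lvl_j; first by lia.
by rewrite saa_formC -saa_form_mul_cyclic xy_0 ?oppr0 //; lia.
Qed.

Lemma triangular_basis_nilpotent : triangular_basis -> saa_nilpotent L.
Proof.
move=> tri; exists (2 * n)%N; apply/eqP; rewrite -subv0.
suff power_level m : (saa_power L m.+1 <= level_space m)%VS.
  apply: subv_trans (power_level _) _; rewrite /level_space.
  by rewrite !big_pred0 ?addv0 // => i; have := ltn_ord i; lia.
elim: m => [|m IHm].
  apply/subvP => u _; apply: mem_level_space => i; first by lia.
  by have := ltn_ord i; lia.
apply/saa_prodvP => u v /(subvP IHm) u_m _; exact: level_space_mul.
Qed.

End Triangularity.

(** * The algebra defined by given coefficients *)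

(** The determinant of the values of f, g, h at u, v, w, expanded so that rotation
    of the arguments permutes the three summands. *)
Definition det3 (F : fieldType) (T : Type) (f g h : T -> F) (u v w : T) : F :=
  f u * (g v * h w - h v * g w) + f v * (g w * h u - h w * g u)
    + f w * (g u * h v - h u * g v).

Section Construction.
Variables (F : fieldType) (n : nat) (alpha beta : 'I_n -> 'I_n -> 'I_n -> F).
Local Notation V := ('rV[F]_n * 'rV[F]_n)%type.
Implicit Types u v w : V.

Definition x_coord (i : 'I_n) u : F := u.1 0 i.
Definition y_coord (i : 'I_n) u : F := u.2 0 i.
Definition x_vec (i : 'I_n) : V := (delta_mx 0 i, 0).
Definition y_vec (i : 'I_n) : V := (0, delta_mx 0 i).

Lemma x_coord_x i j : x_coord i (x_vec j) = (i == j)%:R.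
Proof. by rewrite /x_coord mxE eqxx. Qed.
Lemma x_coord_y i j : x_coord i (y_vec j) = 0.
Proof. by rewrite /x_coord mxE. Qed.
Lemma y_coord_x i j : y_coord i (x_vec j) = 0.
Proof. by rewrite /y_coord mxE. Qed.
Lemma y_coord_y i j : y_coord i (y_vec j) = (i == j)%:R.
Proof. by rewrite /y_coord mxE eqxx. Qed.
Definition coordE := (x_coord_x, x_coord_y, y_coord_x, y_coord_y).

(** Increasing triples of indices agree as sets only when they agree entry by
    entry, so only the diagonal term of the determinant can be nonzero. *)
Lemma det3_xyy (a b c i j k : 'I_n) : (a < b < c)%N -> (i < j < k)%N ->
  det3 (x_coord a) (y_coord b) (y_coord c) (x_vec i) (y_vec j) (y_vec k)
    = [&& a == i, b == j & c == k]%:R.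
Proof.
move=> abc ijk; rewrite /det3 !coordE -!val_eqE /=.
by do 5?[case: eqP => ?; try (exfalso; lia)]; rewrite /=; ring.
Qed.

Lemma det3_yyy (a b c i j k : 'I_n) : (a < b < c)%N -> (i < j < k)%N ->
  det3 (y_coord a) (y_coord b) (y_coord c) (y_vec i) (y_vec j) (y_vec k)
    = [&& a == i, b == j & c == k]%:R.
Proof.
move=> abc ijk; rewrite /det3 !coordE -!val_eqE /=.
by do 9?[case: eqP => ?; try (exfalso; lia)]; rewrite /=; ring.
Qed.

Lemma det3_yyy_xyy (a b c i j k : 'I_n) :
  det3 (y_coord a) (y_coord b) (y_coord c) (x_vec i) (y_vec j) (y_vec k) = 0.
Proof. by rewrite /det3 !coordE; ring. Qed.

Lemma det3_xyy_yyy (a b c i j k : 'I_n) :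
  det3 (x_coord a) (y_coord b) (y_coord c) (y_vec i) (y_vec j) (y_vec k) = 0.
Proof. by rewrite /det3 !coordE; ring. Qed.

Lemma coord_expansion u :
  u = \sum_i x_coord i u *: x_vec i + \sum_i y_coord i u *: y_vec i.
Proof.
case: u => a b; apply: injective_projections; rewrite raddfD !raddf_sum /=.
  rewrite [X in _ + X]big1 ?addr0 => [|i _]; last exact: scaler0.
  exact: row_sum_delta.
rewrite [X in X + _]big1 ?add0r => [|i _]; last exact: scaler0.
exact: row_sum_delta.
Qed.

Definition std_form u v :=
  \sum_i (x_coord i u * y_coord i v - y_coord i u * x_coord i v).

(** The sum of alpha(i,j,k) x_i* /\ y_j* /\ y_k* + beta(i,j,k) y_i* /\ y_j* /\ y_k*
    over i < j < k, where stars denote coordinate functions. *)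
Definition presented_triple u v w : F :=
  \sum_(t : 'I_n * 'I_n * 'I_n | (t.1.1 < t.1.2 < t.2)%N)
    (alpha t.1.1 t.1.2 t.2 * det3 (x_coord t.1.1) (y_coord t.1.2) (y_coord t.2) u v w
     + beta t.1.1 t.1.2 t.2 * det3 (y_coord t.1.1) (y_coord t.1.2) (y_coord t.2) u v w).

(** Each 3 x 3 determinant is alternating, hence invariant under rotation. *)
Lemma presented_triple_cyclic u v w :
  presented_triple u v w = presented_triple v w u.
Proof. by apply: eq_bigr => t _; rewrite /det3; ring. Qed.

Lemma presented_triple_alternating u w : presented_triple u u w = 0.
Proof. by apply: big1 => t _; rewrite /det3; ring. Qed.

Lemma presented_triple_is_linear u v : scalar (presented_triple u v).
Proof.
move=> c w z; rewrite /presented_triple mulr_sumr -big_split /=.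
by apply: eq_bigr => t _; rewrite /det3 /x_coord /y_coord /= !mxE; ring.
Qed.

HB.instance Definition _ u v :=
  GRing.isLinear.Build F V F *%R (presented_triple u v)
    (presented_triple_is_linear u v).

(** The vector that represents the functional w |-> (uv, w) for [std_form]: its
    x-coordinates are the values at the y_i, and its y-coordinates are minus the
    values at the x_i. *)
Definition presented_mul u v : V :=
  (\row_i presented_triple u v (y_vec i), \row_i - presented_triple u v (x_vec i)).

Lemma std_form_is_bilinear : bilinear_for *%R *%R std_form.
Proof.
split=> w c u v /=; rewrite /std_form mulr_sumr -big_split /=;
  by apply: eq_bigr => i _; rewrite /x_coord /y_coord /= !mxE; ring.
Qed.

HB.instance Definition _ := bilinear_isBilinear.Build F V V F *%R *%R
  std_form std_form_is_bilinear.

Lemma presented_mul_is_bilinear : bilinear_for *:%R *:%R presented_mul.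
Proof.
split=> w c u v /=; congr (_, _); apply/rowP => i; rewrite !mxE.
- by rewrite !(presented_triple_cyclic _ w) presented_triple_is_linear.
- by rewrite !(presented_triple_cyclic _ w) presented_triple_is_linear; ring.
- by rewrite -!(presented_triple_cyclic _ w) presented_triple_is_linear.
- by rewrite -!(presented_triple_cyclic _ w) presented_triple_is_linear; ring.
Qed.

HB.instance Definition _ := bilinear_isBilinear.Build F V V V *:%R *:%R
  presented_mul presented_mul_is_bilinear.

Lemma std_form_alternating u : std_form u u = 0.
Proof. by apply: big1 => i _; rewrite mulrC subrr. Qed.

Lemma std_form_y_vec u i : std_form u (y_vec i) = x_coord i u.
Proof.
rewrite /std_form (big_only1 i) // => [|j /negPf ji _]; rewrite !coordE.
  by rewrite eqxx mulr1 mulr0 subr0.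
by rewrite ji !mulr0 subr0.
Qed.

Lemma std_form_x_vec u i : std_form u (x_vec i) = - y_coord i u.
Proof.
rewrite /std_form (big_only1 i) // => [|j /negPf ji _]; rewrite !coordE.
  by rewrite eqxx mulr1 mulr0 add0r.
by rewrite ji !mulr0 subr0.
Qed.

Lemma std_form_nondegenerate u : (forall v, std_form u v = 0) -> u = 0.
Proof.
move=> u0; rewrite [u]coord_expansion !big1 ?addr0 // => i _.
  by rewrite -[y_coord i u]opprK -std_form_x_vec u0 oppr0 scale0r.
by rewrite -std_form_y_vec u0 scale0r.
Qed.

Lemma std_form_mul u v w : std_form (presented_mul u v) w = presented_triple u v w.
Proof.
rewrite [w in RHS]coord_expansion linearD !linear_sum -big_split /=.
apply: eq_bigr => i _; rewrite !linearZ /= /x_coord /y_coord !mxE; ring.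
Qed.

Lemma std_form_mul_cyclic u v w :
  std_form (presented_mul u v) w = std_form (presented_mul v w) u.
Proof. by rewrite !std_form_mul presented_triple_cyclic. Qed.

Lemma presented_mul_alternating u : presented_mul u u = 0.
Proof.
by congr (_, _); apply/rowP => i; rewrite !mxE presented_triple_alternating ?oppr0.
Qed.

Definition presented_saa : saa F :=
  @SAA F V std_form presented_mul std_form_alternating std_form_nondegenerate
    presented_mul_alternating std_form_mul_cyclic.

Lemma dim_presented_saa : \dim {: presented_saa} = (2 * n)%N.
Proof. by rewrite dimvf mul2n -addnn -[n in RHS]mul1n. Qed.

Lemma presented_saa_presentation :
  @nilpotent_presentation F presented_saa n x_vec y_vec alpha beta.
Proof.
have std : @standard_basis F presented_saa n x_vec y_vec.
  apply: (standard_basisP dim_presented_saa) => i j /=.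
  - by rewrite std_form_x_vec coordE oppr0.
  - by rewrite std_form_y_vec coordE.
  - by rewrite std_form_y_vec coordE eq_sym.
apply: (triangular_basis_presentation std); first split.
- move=> i j w /=; rewrite std_form_mul; apply: big1 => t _.
  by rewrite /det3 !coordE; ring.
- move=> i j w le_ji /=; rewrite std_form_mul; apply: big1 => t lt_t.
  rewrite /det3 !coordE.
  have [eq_i|_] := eqVneq t.1.1 i; last by rewrite /=; ring.
  have [eq_j|_] := eqVneq t.1.2 j; first by move: lt_t; rewrite eq_i eq_j; lia.
  have [eq_j|_] := eqVneq t.2 j; first by move: lt_t; rewrite eq_i eq_j; lia.
  by rewrite /=; ring.
- move=> i j k ijk; rewrite [LHS]std_form_mul /presented_triple.
  rewrite (big_only1 (i, j, k)) //= => [|[[a b] c] /= + abc].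
    by rewrite det3_xyy // det3_yyy_xyy !eqxx mulr1 mulr0 addr0.
  rewrite det3_xyy // det3_yyy_xyy -[(a, b, c) == _]/([&& _ && _ & _]) -andbA.
  by move=> /negPf->; rewrite !mulr0 addr0.
- move=> i j k ijk; rewrite [LHS]std_form_mul /presented_triple.
  rewrite (big_only1 (i, j, k)) //= => [|[[a b] c] /= + abc].
    by rewrite det3_xyy_yyy det3_yyy // !eqxx mulr1 mulr0 add0r.
  rewrite det3_xyy_yyy det3_yyy // -[(a, b, c) == _]/([&& _ && _ & _]) -andbA.
  by move=> /negPf->; rewrite !mulr0 addr0.
Qed.



End Construction.

Theorem mainTheorem1 (F : fieldType) (n : nat) (n_gt0 : (0 < n)%N) :
  (forall L : saa F,
     \dim {:L} = (2 * n)%N -> saa_nilpotent L ->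
     exists (x y : 'I_n -> L) (alpha beta : 'I_n -> 'I_n -> 'I_n -> F),
       nilpotent_presentation x y alpha beta)
  /\
  (forall alpha beta : 'I_n -> 'I_n -> 'I_n -> F,
     (exists (L : saa F) (x y : 'I_n -> L),
        \dim {:L} = (2 * n)%N /\ nilpotent_presentation x y alpha beta)
     /\
     (forall (L : saa F) (x y : 'I_n -> L),
        \dim {:L} = (2 * n)%N -> nilpotent_presentation x y alpha beta ->
        saa_nilpotent L)).
Proof.
split=> [L dimL nilL | alpha beta]; last split.
- have [s size_s flag_s] := lagrangian_isotropic_flag dimL nilL.
  pose X := Tuple (introT eqP size_s); have [free_X iso_X _] := flag_s.
  have [y std] := @lagrangian_standard_basis _ _ _ X dimL free_X iso_X.
  have tri := isotropic_flag_triangular (fun=> erefl) (flag_s : isotropic_flag X) std.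
  exists (fun i => X`_i), y.
  exists (fun i j k => saa_form L (saa_mul L X`_i (y j)) (y k)).
  exists (fun i j k => saa_form L (saa_mul L (y i) (y j)) (y k)).
  exact: triangular_basis_presentation.
- exists (presented_saa alpha beta), (@x_vec F n), (@y_vec F n).
  by split; [apply: dim_presented_saa | apply: presented_saa_presentation].
- move=> L x y _ pres; have [std _ _ _] := pres.
  exact: triangular_basis_nilpotent std (presentation_triangular std pres).
Qed.
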